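(* Let $0\le a<b$ be real numbers. Let $w:[a,b]\to[0,\infty)$ be a probability density function, i.e. $w$ is integrable with $\int_a^b w(t)\,dt=1$, and set $W(t)=\int_a^t w(x)\,dx$ for $a\le t\le b$, $W(t)=0$ for $t<a$ and $W(t)=1$ for $t>b$. Let $f:[a,b]\to\mathbb{R}$ be a differentiable function on $[a,b]$ such that $f'\in L_p[a,b]$, where $p>1$ and $\frac1p+\frac1q=1$, and let $\alpha\ge 0$. Then $$\left|\Gamma(\alpha+1)\,J_a^{\alpha}f(b)-(b-a)^{\alpha}\int_a^b w(s)f(s)\,ds\right|\le \|f'\|_p\,(b-a)^{\alpha}\left[\left(\int_a^b|W(s)-1|^q\,ds\right)^{1/q}+\left(\frac{b-a}{\alpha q+1}\right)^{1/q}\right].$$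
   Context: For $a\ge 0$, the Riemann-Liouville fractional integral operator of order $\alpha\ge 0$ is defined by $$J_a^{\alpha}f(x)=\frac{1}{\Gamma(\alpha)}\int_a^x (x-t)^{\alpha-1}f(t)\,dt\quad(\alpha>0),\qquad J_a^{0}f(x)=f(x),$$ where $\Gamma$ is the Gamma function. The norm is $\|f'\|_p=\left(\int_a^b|f'(s)|^p\,ds\right)^{1/p}$. *)

(* Defs.v *)
From HB Require Import structures.
From mathcomp Require Import all_boot all_order all_algebra.
From mathcomp Require Import all_classical all_reals all_analysis.

Set Implicit Arguments.
Unset Strict Implicit.
Unset Printing Implicit Defensive.

Import Order.TTheory GRing.Theory Num.Theory.
Import numFieldNormedType.Exports.

Local Open Scope classical_set_scope.
Local Open Scope ring_scope.

(* Lebesgue measure on the full Lebesgue sigma-algebra (not only on Borel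
   sets), so that "integrable" below has its usual Lebesgue meaning. *)
Notation leb := (@completed_lebesgue_measure _).

Definition Gamma {R : realType} (s : R) : R :=
  \int[leb]_(t in `]0, +oo[) (t `^ (s - 1) * expR (- t)).

Definition RL_integral {R : realType} (a alpha : R) (f : R -> R) (x : R) : R :=
  if alpha == 0 then f x
  else (Gamma alpha)^-1 *
       \int[leb]_(t in `[a, x]) ((x - t) `^ (alpha - 1) * f t).

(* Derivative relative to a set [D]: two-sided in the interior of an interval,
   one-sided at its endpoints. *)
Definition derivable_within {R : realType} (D : set R) (f : R -> R) (x : R) :=
  cvg ((f y - f x) / (y - x) @[y --> within D x^']).

Definition derive_within {R : realType} (D : set R) (f : R -> R) (x : R) : R :=
  lim ((f y - f x) / (y - x) @[y --> within D x^']).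

Definition is_pdf {R : realType} (a b : R) (w : R -> R) :=
  [/\ forall t, t \in `[a, b] -> 0 <= w t,
      leb.-integrable `[a, b] (EFin \o w)
    & \int[leb]_(t in `[a, b]) w t = 1].

Definition cdf_on {R : realType} (a b : R) (w : R -> R) (t : R) : R :=
  if t < a then 0 else if b < t then 1 else \int[leb]_(x in `[a, t]) w x.

(* [Lfun] includes measurability; [p] is finite here. *)
Definition in_Lp {R : realType} (a b p : R) (g : R -> R) :=
  (g \_ `[a, b]) \in Lfun (@completed_lebesgue_measure R) p%:E.

Definition Lp_norm {R : realType} (a b p : R) (g : R -> R) : R :=
  (\int[leb]_(s in `[a, b]) (`|g s| `^ p)) `^ p^-1.

(* Main.v *)
Require Import Defs.
From HB Require Import structures.
From mathcomp Require Import all_boot all_order all_algebra.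
From mathcomp Require Import all_classical all_reals all_analysis.
From mathcomp Require Import measurable_realfun ring lra.

Set Implicit Arguments.
Unset Strict Implicit.
Unset Printing Implicit Defensive.

Import Order.TTheory GRing.Theory Num.Theory.
Import numFieldNormedType.Exports.

Local Open Scope classical_set_scope.
Local Open Scope ring_scope.

(** Let v be a probability density on [a, b] and let V s be the mass of v on
    [s, b]. Since f t = f a plus the integral of f' over [a, t], exchanging the
    order of integration gives

      (mean of f for v) - f a = integral over [a, b] of f' V,

    and Hoelder's inequality bounds the right-hand side by the product of the
    p-norm of f' and the q-norm of V ([weighted_mean_bound]). The theorem is the
    triangle inequality, through f a, for two such densities.

    - For v = w the tail V is 1 - W.
    - For v t = alpha (b - t) ^ (alpha - 1) / (b - a) ^ alpha, with alpha > 0, the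
      mean of f is Gamma (alpha + 1) J f b / (b - a) ^ alpha, the tail is
      ((b - s) / (b - a)) ^ alpha, and its q-norm is
      ((b - a) / (alpha q + 1)) ^ (1 / q). When alpha = 0 the density degenerates
      to a point mass at b, with tail 1, and the estimate is the fundamental
      theorem of calculus followed by Hoelder's inequality.

    Two ingredients carry the argument. The derivative f' is only known to exist
    everywhere and to be integrable, so that the formula for f t is the
    fundamental theorem of calculus in its strong form ([slope_FTC]). It rests on
    [increment_le_integral], which bounds the increments of a continuous function
    by the integral of a measurable upper bound of its upper right derivative,
    using open neighbourhoods of the level sets of that bound and real induction.
    And replacing Gamma (alpha + 1) / Gamma alpha by alpha takes the functional
    equation of the Gamma integral, together with its finiteness and positivity,
    which are obtained from Tonelli's theorem. *)

(** The carrier of the completed Lebesgue measure: the reals with the sigma-algebra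
    of all Lebesgue measurable sets. Ascribing it to a set or to a function selects
    that sigma-algebra instead of the Borel one. *)
Notation lebType R := (caratheodory_type ((@wlength R idfun)^*)%mu).

(** * The completed Lebesgue measure compared with the Borel one *)

Section bridge.
Context {R : realType}.
Implicit Types a b : R.
Local Open Scope ereal_scope.

Lemma measurable_borel_leb (A : set R) :
  measurable A -> measurable (A : set (lebType R)).
Proof. exact: sub_caratheodory. Qed.

(** The identity from the Lebesgue to the Borel sigma-algebra: composing with
    it transports Borel measurability. *)
Lemma measurable_id_leb :
  measurable_fun setT (idfun : lebType R -> R).
Proof. by move=> _ Y mY; rewrite setTI; exact: measurable_borel_leb. Qed.

Lemma measurable_fun_borel_leb d (T : measurableType d) (D : set R)
    (f : R -> T) :
  measurable D -> measurable_fun D f ->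
  measurable_fun (D : set (lebType R)) (f : lebType R -> T).
Proof.
by move=> mD mf _ Y mY; apply: measurable_borel_leb; exact: mf.
Qed.

Lemma leb_borelE (A : set R) : leb A = lebesgue_measure A.
Proof. by []. Qed.

(** Lebesgue measure on Borel sets is the image of its completion under the
    identity, so this is a change of variables along the identity. It gives
    access to the fundamental theorem of calculus for the Borel measure. *)
Lemma ge0_integral_leb (D : set R) (f : R -> \bar R) :
  measurable D -> measurable_fun D f ->
  (forall x, D x -> 0 <= f x) ->
  \int[leb]_(x in D) f x = \int[lebesgue_measure]_(x in D) f x.
Proof.
move=> mD mf f0.
have mid : measurable_fun setT (idfun : lebType R -> measurableTypeR R).
  exact: measurable_id_leb.
have := @ge0_integral_pushforward _ _ (lebType R) (measurableTypeR R) R idfun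
  mid leb D f mD mf.
rewrite preimage_id => /(_ _)/esym -> //.
by move=> x; rewrite inE; exact: f0.
Qed.

(** A Lebesgue measurable set is a Borel set up to a null set, and a null set
    lies in a null Borel set: outer regularity follows from the Borel case. *)
Lemma leb_regularity_outer (D : set R) (e : R) :
  measurable (D : set (lebType R)) -> leb D < +oo -> (0 < e)%R ->
  exists U : set R, [/\ open U, D `<=` U & leb (U `\` D) < e%:E].
Proof.
move=> mD Doo e0.
have : (completed_algebra_gen (@lebesgue_measure R)).-sigma.-measurable D.
  by rewrite completed_caratheodory_measurable.
rewrite g_sigma_completed_algebra_genE => -[A mA [N [B [mB B0 NB]] DE]].
(* Apply the Borel case to the Borel superset A `|` B of D, whose measure
   is that of D. *)
have mAB : measurable (A `|` B) by exact: measurableU.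
have DAB : D `<=` A `|` B by rewrite -DE; exact: setUS.
have AB : lebesgue_measure (A `|` B) <= leb D.
  rewrite (le_trans (measureU2 _ _ _))//= B0 adde0.
  by apply: le_outer_measure; rewrite -DE; exact: subsetUl.
have [U [oU ABU Ue]] := lebesgue_regularity_outer mAB (le_lt_trans AB Doo) e0.
exists U; split => //; first exact: subset_trans ABU.
apply: le_lt_trans Ue.
apply: (@le_trans _ _ (leb ((U `\` (A `|` B)) `|` B))).
  apply: le_outer_measure => x [Ux Dx].
  have [Bx|Bx] := pselect (B x); [by right|left; split => // -[Ax|//]].
  by apply: Dx; rewrite -DE; left.
have mU : measurable U by exact: open_measurable.
rewrite leb_borelE (le_trans (measureU2 _ _ _))//= ?B0 ?adde0//.
exact: measurableD.
Qed.

Lemma leb_itv (i : interval R) :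
  leb [set` i] = (if i.1 < i.2 then (i.2 : \bar R) - i.1 else 0).
Proof. by rewrite leb_borelE lebesgue_measure_itv. Qed.

Lemma measurable_itv_leb (i : interval R) :
  measurable ([set` i] : set (lebType R)).
Proof. by apply: measurable_borel_leb; exact: measurable_itv. Qed.

Lemma measurable_open_leb (U : set R) :
  open U -> measurable (U : set (lebType R)).
Proof. by move=> oU; apply: measurable_borel_leb; exact: open_measurable. Qed.

Lemma leb_itvcc a b : (a <= b)%R -> leb (`[a, b] : set R) = (b - a)%:E.
Proof.
rewrite leb_itv/= lte_fin => ab; have [//|ba] := ltP a b.
by rewrite (_ : b = a) ?subrr//; apply/eqP; rewrite eq_le ab ba.
Qed.

Lemma integrable_cst_itv a b (k : R) :
  leb.-integrable `[a, b] (cst k%:E : lebType R -> \bar R).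
Proof.
have mD := measurable_itv_leb `[a, b].
apply/integrableP; split; first exact: measurable_cst.
have lab : leb (`[a, b]%classic : set R) < +oo.
  by rewrite leb_itv; case: ifP => _; rewrite ltry.
by rewrite (integral_cst leb mD `|k%:E|) lte_mul_pinfty.
Qed.

End bridge.

(** * Increments of a function and bounds of its right derivative *)

Section dini.
Context {R : realType}.
Implicit Types (a b : R) (F h : R -> R).
Local Open Scope ereal_scope.

(** Real induction: a local bound on the increments of F by those of a
    nondecreasing Phi, to the right of every point, propagates to the whole
    interval. The supremum of the points reached is itself reached, by continuity
    of F and monotonicity of Phi, and cannot be less than b. Phi takes extended
    real values because it will be a sum of a series of measures. *)
Lemma increment_le_monotone a b F (Phi : R -> \bar R) :
  (a <= b)%R -> {within `[a, b], continuous F} ->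
  {in `[a, b] &, forall x y, (x <= y)%R -> Phi x <= Phi y} -> 0 <= Phi a ->
  (forall x, x \in `[a, b[ -> \forall t \near x^'+,
     Phi x + (F t - F x)%:E <= Phi t) ->
  (F b - F a)%:E <= Phi b.
Proof.
move=> ab cF mono Phi0 step.
pose S := [set x | x \in `[a, b] /\ (F x - F a)%:E <= Phi x].
have Sa : S a by split; rewrite ?in_itv/= ?lexx// subrr.
have hS : has_sup S.
  by split; [exists a | exists b => x [] /itvP xab _; rewrite xab].
pose c := sup S.
have acb : c \in `[a, b].
  rewrite in_itv/= ub_le_sup//=; last by case: hS.
  by apply: ge_sup => // [|x [] /itvP xab _]; [exists a|rewrite xab].
have Sc : S c.
  split => //; apply/lee_addgt0Pr => e e0.
  have /cvgrPdist_lt /(_ _ e0) : F x @[x --> within `[a, b] (nbhs c)] --> F c.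
    by move/subspace_continuousP : cF; apply.
  rewrite near_withinE => -[/= d d0 /= cd].
  have [x Sx cx] := sup_adherent d0 hS.
  have xc : (x <= c)%R by apply: ub_le_sup => //; case: hS.
  have [xab Fx] := Sx.
  have := cd x; rewrite /ball/= ger0_norm ?subr_ge0// => /(_ _ xab) Fcx.
  have {}Fcx : (F c - F x <= e)%R.
    by rewrite (le_trans (ler_norm _))// ltW// Fcx// ltrBlDr addrC -ltrBlDr.
  rewrite (_ : F c - F a = (F x - F a) + (F c - F x))%R; last by ring.
  by rewrite EFinD leeD ?lee_fin//; apply: (le_trans Fx); exact: mono.
have [cb|cb] := ltP c b; last first.
  have -> : b = c by apply/eqP; rewrite eq_le cb (itvP acb).
  by case: Sc.
have cab : c \in `[a, b[ by rewrite in_itv/= (itvP acb).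
have : \forall t \near c^'+, False.
  near=> t.
  have ct : (c < t)%R by near: t; exact: nbhs_right_gt.
  have tb : (t < b)%R by near: t; exact: nbhs_right_lt.
  have : (t <= c)%R.
    apply: ub_le_sup; first by case: hS.
    split; first by rewrite in_itv/= (ltW tb) (le_trans _ (ltW ct))// (itvP acb).
    rewrite (_ : F t - F a = (F c - F a) + (F t - F c))%R; last by ring.
    rewrite EFinD; apply: (@le_trans _ _ (Phi c + (F t - F c)%:E)).
      by rewrite leeD2r//; case: Sc.
    by near: t; exact: step.
  by rewrite leNgt ct.
by move=> /filter_ex[].
Unshelve. all: by end_near. Qed.

(** The Vitali-Caratheodory approximation of a nonnegative h from above by a
    lower semicontinuous function, in the form that is used: with V_n an open
    set slightly larger than the level set {n e <= h < (n + 1) e}, the sum of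
    the functions (n + 1) e 1_(V_n) exceeds the value h x on a neighbourhood of
    each x in D, and its integral is close to that of h. *)
Lemma open_level_cover (D : set (lebType R)) (h : lebType R -> R) (e : R) :
  measurable D -> leb D < +oo -> measurable_fun D h ->
  (forall x, D x -> 0 <= h x)%R -> (0 < e)%R ->
  exists V : (set R)^nat,
  [/\ forall n, open (V n),
      forall x, D x -> exists2 n, V n x & (h x < n.+1%:R * e)%R &
      \sum_(0 <= n <oo) ((n.+1%:R * e)%R%:E * leb (V n)) <=
      \int[leb]_(x in D) (h x)%:E + e%:E * leb D + e%:E ].
Proof.
move=> mD Doo mh h0 e0.
pose E n : set (lebType R) := D `&` h @^-1` `[(n%:R * e)%R, (n.+1%:R * e)%R[.
have mE n : measurable (E n) by exact: mh.
have Eoo n : leb (E n) < +oo.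
  by apply: le_lt_trans Doo; apply: le_outer_measure; exact: subIsetl.
(* The excess measure allowed for V_n, chosen so that the weighted excesses
   sum to e. *)
pose d n := (e / (2 ^ n.+1)%:R / (n.+1%:R * e))%R.
have d0 n : (0 < d n)%R by rewrite !divr_gt0 ?mulr_gt0// ltr0n// expn_gt0.
have /choice[V HV] : forall n, exists U : set R,
    [/\ open U, E n `<=` U & leb (U `\` E n) < (d n)%:E].
  by move=> n; exact: leb_regularity_outer.
have DE : D = \bigcup_n E n.
  apply/seteqP; split => [x Dx|x [n _ []]//].
  have he0 : (0 <= h x / e)%R by rewrite divr_ge0 ?h0// ltW.
  exists (Num.truncn (h x / e)) => //; split => //=.
  have /andP[h1 h2] := truncn_itv he0.
  by rewrite in_itv/= -ler_pdivlMr// h1 -ltr_pdivrMr.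
have tE : trivIset setT E.
  move=> i j _ _ [x [[_ /=]]]; rewrite in_itv/= => /andP[i1 i2] [_ /=].
  rewrite in_itv/= => /andP[j1 j2]; apply/eqP.
  rewrite eqn_leq -[(i <= j)%N]ltnS -[(j <= i)%N]ltnS -!(ltr_nat R).
  rewrite -[(i%:R < _)%R](ltr_pM2r e0) -[(j%:R < _)%R](ltr_pM2r e0).
  by rewrite (le_lt_trans i1)// (le_lt_trans j1).
have mhE : measurable_fun D (EFin \o h).
  by apply: measurableT_comp => //; exact: mh.
have mhe : measurable_fun D (fun x : lebType R => (h x)%:E + e%:E).
  by apply: emeasurable_funD => //; exact: mhE.
exists V; split.
- by move=> n; have [] := HV n.
- move=> x; rewrite {1}DE => -[n _ Enx]; exists n.
    by have [_ + _] := HV n; exact.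
  by case: Enx => _ /=; rewrite in_itv/= => /andP[].
apply: (@le_trans _ _ (\sum_(0 <= n <oo) (\int[leb]_(x in E n) ((h x)%:E + e%:E)
    + (e / (2 ^ n.+1)%:R)%:E))).
  apply: lee_nneseries => n _; first by rewrite mule_ge0// lee_fin mulr_ge0// ltW.
  have [oV EV VE] := HV n.
  have -> : leb (V n) = leb (V n `\` E n) + leb (E n).
    rewrite -measureU//; first by rewrite setDKU.
      by apply: measurableD => //; exact: measurable_open_leb.
    by rewrite setDE -setIA setICl setI0.
  rewrite muleDr//; last by rewrite ge0_adde_def// inE measure_ge0.
  rewrite addeC leeD//.
    rewrite (le_trans (lee_wpmul2l _ (ltW VE)))//.
      by rewrite lee_fin mulr_ge0// ltW.
    by rewrite -EFinM lee_fin /d mulrC divfK// mulf_neq0// gt_eqF.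
  rewrite -(integral_cst leb (mE n)); apply: ge0_le_integral.
  - exact: mE.
  - by move=> x _; rewrite lee_fin mulr_ge0// ltW.
  - exact: measurable_cst.
  - by apply: (measurable_funS mD) => //; exact: subIsetl.
  move=> x [_ /=]; rewrite in_itv/= -EFinD lee_fin => /andP[nh _].
  by rewrite -natr1 mulrDl mul1r lerD2r.
apply: (le_trans (epsilon_trick _ _ _)).
- move=> n; apply: integral_ge0 => x [Dx _].
  by rewrite -EFinD lee_fin addr_ge0 ?h0// ltW.
- exact: ltW.
apply: leeD2r; rewrite -(ge0_integral_bigcup leb mE); last 3 first.
- by rewrite -DE.
- by move=> x; rewrite -DE => Dx; rewrite -EFinD lee_fin addr_ge0 ?h0// ltW.
- exact: tE.
rewrite -DE ge0_integralD; last 5 first.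
- exact: mD.
- by move=> x Dx; rewrite lee_fin h0.
- exact: mhE.
- by move=> *; rewrite lee_fin ltW.
- exact: measurable_cst.
by rewrite integral_cst.
Qed.

(** This is the step that takes the place of absolute continuity. Apply real
    induction with Phi x the integral up to x of the open approximation of h:
    each x lies in some V_n with h x < (n + 1) e, and on a right neighbourhood
    of x contained in V_n both F and Phi are controlled by the slope
    (n + 1) e. *)
Lemma increment_le_integral a b F (h : lebType R -> R) :
  (a <= b)%R -> {within `[a, b], continuous F} ->
  measurable_fun (`[a, b] : set (lebType R)) h ->
  (forall x, x \in `[a, b] -> 0 <= h x)%R ->
  (forall x, x \in `[a, b[ -> forall c, (h x < c)%R ->
    \forall t \near x^'+, (F t - F x <= c * (t - x))%R) ->
  (F b - F a)%:E <= \int[leb]_(x in `[a, b]) (h x)%:E.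
Proof.
move=> ab cF mh h0 Dini; apply/lee_addgt0Pr => e e0.
have lab := leb_itvcc ab.
(* The cover with step e' overshoots by e' (b - a) + e', which is e. *)
pose e' := (e / (b - a + 1))%R.
have ba1 : (0 < b - a + 1)%R by rewrite ltr_wpDl ?subr_ge0.
have e'0 : (0 < e')%R by rewrite divr_gt0.
have [V [oV Vh sumV]] : exists V : (set R)^nat,
  [/\ forall n, open (V n),
      forall x, x \in `[a, b] -> exists2 n, V n x & (h x < n.+1%:R * e')%R &
      \sum_(0 <= n <oo) ((n.+1%:R * e')%R%:E * leb (V n)) <=
      \int[leb]_(x in `[a, b]) (h x)%:E + e%:E ].
  have [| |//|//|//|V [oV Vh sumV]] := @open_level_cover `[a, b] h e'.
  - exact: measurable_itv_leb.
  - by rewrite [ltLHS]lab ltry.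
  exists V; split => //; apply: (le_trans sumV).
  rewrite -addeA leeD2l// [X in _ * X + _]lab -EFinM -EFinD lee_fin.
  have -> : (e' * (b - a) + e' = e' * (b - a + 1))%R by ring.
  by rewrite /e' divfK// gt_eqF.
apply: le_trans sumV.
pose Phi x := \sum_(0 <= n <oo) ((n.+1%:R * e')%R%:E * leb (V n `&` `]-oo, x])).
have c0 n : 0 <= (n.+1%:R * e')%R%:E by rewrite lee_fin mulr_ge0// ltW.
apply: (@le_trans _ _ (Phi b)); last first.
  apply: lee_nneseries => n _; first by rewrite mule_ge0.
  by apply: lee_wpmul2l => //; apply: le_outer_measure; exact: subIsetl.
apply: (increment_le_monotone ab cF).
- move=> x y _ _ xy; apply: lee_nneseries => n _; first by rewrite mule_ge0.
  apply: lee_wpmul2l => //; apply: le_outer_measure; apply: setIS.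
  by move=> z /=; rewrite !in_itv/= => /le_trans; exact.
- by apply: nneseries_ge0 => n _ _; rewrite mule_ge0.
move=> x xab; have xab' : x \in `[a, b] by exact: subset_itv_co_cc xab.
have [n Vnx hn] := Vh _ xab'.
(* On a right neighbourhood contained in V_n, the n-th term alone makes Phi
   grow with slope (n + 1) e' > h x. *)
have nearV : \forall t \near x^'+, `]x, t] `<=` V n.
  have /nbhs_ballP[d /= d0 dV] := open_nbhs_nbhs (conj (oV n) Vnx).
  near=> t => z /=; rewrite in_itv/= => /andP[xz zt]; apply: dV.
  rewrite /ball/= ltr0_norm ?subr_lt0// opprB ltrBlDr (le_lt_trans zt)//.
  by near: t; apply: nbhs_right_lt; rewrite ltrDr.
near=> t.
have xt : (x < t)%R by near: t; exact: nbhs_right_gt.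
have -> : Phi t = Phi x +
    \sum_(0 <= n <oo) ((n.+1%:R * e')%R%:E * leb (V n `&` `]x, t])).
  rewrite -nneseriesD; last 2 first.
  - by move=> i _ _; rewrite mule_ge0.
  - by move=> i _ _; rewrite mule_ge0.
  apply: eq_eseriesr => i _; rewrite -ge0_muleDr//; congr (_ * _).
  rewrite -measureU.
  - congr leb; rewrite -setIUr; congr setI.
    by rewrite -itv_bndbnd_setU// bnd_simp// ltW.
  - by apply: measurableI; [exact: measurable_open_leb|exact: measurable_itv_leb].
  - by apply: measurableI; [exact: measurable_open_leb|exact: measurable_itv_leb].
  - apply/seteqP; split => // z [[_ /=]]; rewrite in_itv/= => zx [_ /=].
    by rewrite in_itv/= ltNge zx.
apply: leeD2l; rewrite (@nneseriesD1 _ _ n)//; last first.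
  by move=> i _; rewrite mule_ge0.
apply: (@le_trans _ _ ((n.+1%:R * e')%R%:E * leb (V n `&` `]x, t]))); last first.
  by rewrite leeDl// nneseries_ge0// => i _ _; rewrite mule_ge0.
rewrite setIidr; last by near: t.
rewrite leb_itv/= lte_fin xt -EFinB -EFinM lee_fin.
by near: t; exact: Dini.
Unshelve. all: by end_near. Qed.

End dini.

(** * The fundamental theorem of calculus for everywhere differentiable functions *)

Section ftc.
Context {R : realType}.
Implicit Types (a b : R) (f g : R -> R).

(** The function g is the derivative of f relative to D, in the multiplied-out
    form: it survives restriction of D and needs no case y = x. *)
Definition slope_on (D : set R) f g := forall x, D x -> forall e, 0 < e ->
  \forall y \near x, D y -> `|f y - f x - g x * (y - x)| <= e * `|y - x|.

Lemma derivable_within_slope (D : set R) f :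
  (forall x, D x -> derivable_within D f x) ->
  slope_on D f (derive_within D f).
Proof.
move=> df x Dx e e0; have := df x Dx; rewrite /derivable_within.
move/cvgrPdist_le => /(_ _ e0); rewrite !near_withinE.
apply: filterS => y near_y Dy; have [->|yx] := eqVneq y x.
  by rewrite !subrr mulr0 subrr !normr0 mulr0.
have yx1 : y - x != 0 by rewrite subr_eq0.
have := near_y yx Dy; rewrite distrC.
rewrite -(@ler_pM2r _ `|y - x|) ?normr_gt0// -normrM mulrBl divfK//.
Qed.

Lemma slope_continuous (D : set R) f g :
  slope_on D f g -> {within D, continuous f}.
Proof.
move=> fg; apply/subspace_continuousP => x Dx; apply/cvgrPdist_le => e e0.
have := fg x Dx 1 ltr01; rewrite near_withinE => H.
have C0 : 0 < 1 + `|g x| by rewrite ltr_pwDl.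
have nb : \forall y \near x, `|y - x| <= e / (1 + `|g x|).
  have /cvgrPdist_le : y @[y --> x] --> x by exact: cvg_id.
  move=> /(_ (e / (1 + `|g x|))); rewrite divr_gt0// => /(_ isT).
  by apply: filterS => y; rewrite distrC.
apply: filterS2 H nb => y H1 H2 Dy; rewrite distrC.
have -> : f y - f x = (f y - f x - g x * (y - x)) + g x * (y - x) by ring.
rewrite (le_trans (ler_normD _ _))// normrM.
rewrite (le_trans (lerD (H1 Dy) (lexx _)))// -mulrDl mulrC -ler_pdivlMr//.
Qed.

Lemma slope_onS (D E : set R) f g :
  E `<=` D -> slope_on D f g -> slope_on E f g.
Proof.
move=> ED fg x Ex e e0; have := fg x (ED _ Ex) e e0.
by apply: filterS => y + Ey; apply; exact: ED.
Qed.

Lemma slope_onN (D : set R) f g : slope_on D f g -> slope_on D (\- f) (\- g).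
Proof.
move=> fg x Dx e e0; have := fg x Dx e e0.
apply: filterS => y + Dy => /(_ Dy); rewrite -normrN; congr (`|_| <= _).
by rewrite /=; ring.
Qed.

Lemma slope_onD_linear (D : set R) f g c : slope_on D f g ->
  slope_on D (fun x => f x + c * x) (fun x => g x + c).
Proof.
move=> fg x Dx e e0; have := fg x Dx e e0.
apply: filterS => y + Dy => /(_ Dy); congr (`|_| <= _).
by ring.
Qed.

Local Open Scope ereal_scope.

(** To remove the sign condition on the derivative, truncate it from below at
    -n: the function f + n x has a derivative bounded above by the nonnegative
    max(g, -n) + n. Dominated convergence then lets n tend to infinity. *)
Lemma slope_le_integral a b f (g : lebType R -> R) : (a <= b)%R ->
  slope_on `[a, b] f g -> leb.-integrable `[a, b] (EFin \o g) ->
  (f b - f a)%:E <= \int[leb]_(x in `[a, b]) (g x)%:E.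
Proof.
move=> ab fg ig.
have mD : measurable (`[a, b] : set (lebType R)) by exact: measurable_itv_leb.
have lab := leb_itvcc ab.
have mg : measurable_fun (`[a, b] : set (lebType R)) g.
  by apply/measurable_EFinP; exact: measurable_int ig.
pose k n : lebType R -> R := fun x => Num.max (g x) (- n%:R)%R.
have mk n : measurable_fun (`[a, b] : set (lebType R)) (k n).
  by apply: measurable_maxr => //; exact: measurable_cst.
have kg n x : (`|k n x| <= `|g x|)%R.
  rewrite /k; case: (leP (g x) (- n%:R)%R) => // gn.
  have g0 : (g x <= 0)%R by rewrite (le_trans gn)// oppr_le0 ler0n.
  by rewrite normrN ger0_norm ?ler0n// ler0_norm// lerNr.
have ik n : leb.-integrable `[a, b] (EFin \o k n).
  apply: (le_integrable mD _ _ ig) => [|x _]; first exact/measurable_EFinP.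
  by rewrite !abse_EFin lee_fin.
have cvk : \int[leb]_(x in `[a, b]) (k n x)%:E @[n --> \oo] -->
    \int[leb]_(x in `[a, b]) (g x)%:E.
  apply: (@dominated_cvg _ _ _ leb `[a, b] mD (fun n => EFin \o k n)
    (EFin \o g) (fun x => `|(g x)%:E|)).
  - by move=> n; apply/measurable_EFinP.
  - move=> x _; apply: cvg_near_cst; near=> n.
    rewrite /= /k; congr EFin; apply/max_idPl.
    rewrite lerNl (le_trans (ler_norm _))// normrN.
    by near: n; exact: nbhs_infty_ger.
  - by [].
  - exact: integrable_abse.
  - by move=> n x _; rewrite !abse_EFin lee_fin.
apply: (cvge_to_ge cvk); apply: nearW => n.
have nb : (n%:R * (b - a))%:E = \int[leb]_(x in `[a, b]) n%:R%:E.
  by rewrite integral_cst// [X in _ * X]lab.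
have Fg := slope_onD_linear n%:R fg.
have : ((f b + n%:R * b) - (f a + n%:R * a))%:E <=
    \int[leb]_(x in `[a, b]) (k n x + n%:R)%:E.
  apply: (@increment_le_integral _ a b (fun x => f x + n%:R * x)%R _ ab).
  - exact: slope_continuous Fg.
  - by apply: measurable_funD; [exact: mk|exact: measurable_cst].
  - by move=> x _; rewrite -lerBlDr sub0r le_max lexx orbT.
  - move=> x xab c hc.
    have cg : (0 < c - (g x + n%:R))%R.
      by rewrite subr_gt0; apply: le_lt_trans hc; rewrite lerD2r le_max lexx.
    have xab' : x \in `[a, b] by exact: subset_itv_co_cc xab.
    have Fgx := Fg x xab' _ cg.
    near=> t.
    have xt : (x < t)%R by near: t; exact: nbhs_right_gt.
    have tb : (t < b)%R.
      by near: t; apply: nbhs_right_lt; move: xab; rewrite in_itv/= => /andP[].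
    have tab : `[a, b]%classic t.
      by rewrite /= in_itv/= (ltW tb) andbT (le_trans _ (ltW xt))// (itvP xab').
    have : `[a, b]%classic t -> (`|f t + n%:R * t - (f x + n%:R * x) -
        (g x + n%:R) * (t - x)| <= (c - (g x + n%:R)) * `|t - x|)%R.
      by near: t; rewrite near_withinE; apply: filterS Fgx => u Hu _.
    move=> /(_ tab) /(le_trans (ler_norm _)).
    by rewrite ger0_norm ?subr_ge0 ?(ltW xt)// mulrBl lerBlDr subrK.
rewrite integralD_EFin//; last exact: (integrable_cst_itv a b n%:R).
rewrite -nb -leeBlDr// -EFinB; apply: le_trans; rewrite lee_fin; lra.
Unshelve. all: by end_near. Qed.

(** The fundamental theorem of calculus for a function differentiable at every
    point with integrable derivative: the upper estimate for f and for -f. *)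
Theorem slope_FTC a b f (g : lebType R -> R) : (a <= b)%R ->
  slope_on `[a, b] f g -> leb.-integrable `[a, b] (EFin \o g) ->
  (f b - f a = \int[leb]_(x in `[a, b]) g x)%R.
Proof.
move=> ab fg ig; have mD := @measurable_itv_leb R `[a, b].
apply: EFin_inj; rewrite /Rintegral fineK; last exact: integrable_fin_num.
apply/eqP; rewrite eq_le (slope_le_integral ab fg ig)/=.
have := slope_le_integral ab (slope_onN fg).
rewrite (_ : EFin \o (\- g)%R = (fun x => - (EFin \o g) x)); last by [].
move=> /(_ (integrableN ig)).
have -> : \int[leb]_(x in `[a, b]) ((\- g)%R x)%:E =
    - \int[leb]_(x in `[a, b]) (g x)%:E.
  by rewrite -integralN//; exact: integrable_add_def ig.
by rewrite leeNr -EFinN/= opprD !opprK.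
Qed.

End ftc.

(** * Exchange of integrals on a triangle *)

Section triangle.
Context {R : realType}.
Implicit Types (a b : R).
Local Open Scope ereal_scope.
Notation T := (lebType R).

Lemma measurable_leb_snd_le_fst :
  measurable_fun [set: T * T] (fun z : T * T => (z.2 : R) <= (z.1 : R))%R.
Proof.
apply: measurable_fun_ler.
  exact: (@measurableT_comp _ _ _ (T * T)%type T R (idfun : T -> R)
    setT snd measurable_id_leb measurable_snd).
exact: (@measurableT_comp _ _ _ (T * T)%type T R (idfun : T -> R)
    setT fst measurable_id_leb measurable_fst).
Qed.

Lemma measurable_leb_triangle (V G : T -> R) :
  measurable_fun setT V -> measurable_fun setT G ->
  measurable_fun [set: T * T]
    (fun z : T * T => if (z.2 <= z.1)%R then V z.1 * G z.2 else 0)%R.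
Proof.
move=> mV mG; apply: measurable_fun_ifT.
- exact: measurable_leb_snd_le_fst.
- by apply: measurable_funM;
    [apply: measurableT_comp => //; exact: measurable_fst
    |apply: measurableT_comp => //; exact: measurable_snd].
- exact: measurable_cst.
Qed.

(** Fubini for v t g s on the triangle a <= s <= t <= b. With g = 1 the
    measurability statement says that the tail integral of v is measurable. *)
Lemma fubini_triangle a b (v g : T -> R) :
  leb.-integrable `[a, b] (EFin \o v) -> leb.-integrable `[a, b] (EFin \o g) ->
  [/\ leb.-integrable `[a, b]
        (fun t => (v t * \int[leb]_(s in `[a, t]) g s)%:E),
      measurable_fun (`[a, b] : set T)
        (fun s : T => g s * \int[leb]_(t in `[s, b]) v t)%R &
      (\int[leb]_(t in `[a, b]) (v t * \int[leb]_(s in `[a, t]) g s) =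
       \int[leb]_(s in `[a, b]) (g s * \int[leb]_(t in `[s, b]) v t))%R].
Proof.
move=> iv ig.
have mI (i : interval R) : measurable ([set` i] : set T).
  exact: measurable_itv_leb.
pose V : T -> R := (v \_ `[a, b])%R; pose G : T -> R := (g \_ `[a, b])%R.
have iV : leb.-integrable setT (EFin \o V).
  by rewrite /V -restrict_EFin; exact/(integrable_mkcond _ (mI _)).
have iG : leb.-integrable setT (EFin \o G).
  by rewrite /G -restrict_EFin; exact/(integrable_mkcond _ (mI _)).
have mV : measurable_fun [set: T] V.
  by apply/measurable_EFinP; exact: measurable_int iV.
have mG : measurable_fun [set: T] G.
  by apply/measurable_EFinP; exact: measurable_int iG.
pose K (z : T * T) : \bar R :=
  (if (z.2 <= z.1)%R then V z.1 * G z.2 else 0)%R%:E.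
have mK : measurable_fun [set: T * T] K.
  by apply/measurable_EFinP; exact: measurable_leb_triangle.
have mVG : measurable_fun [set: T * T] (fun z : T * T => V z.1 * G z.2)%R.
  by apply: measurable_funM;
      [apply: measurableT_comp => //; exact: measurable_fst
      |apply: measurableT_comp => //; exact: measurable_snd].
have mabsV : measurable_fun [set: T] (fun t => `|(V t)%:E|).
  by apply: measurableT_comp; [exact: abse_measurable|exact: measurable_int iV].
have mabsG : measurable_fun [set: T] (fun t => `|(G t)%:E|).
  by apply: measurableT_comp; [exact: abse_measurable|exact: measurable_int iG].
have iVG : (leb \x leb).-integrable [set: T * T] (fun z => (V z.1 * G z.2)%:E).
  apply/integrable12ltyP; first exact/measurable_EFinP.
  have eqt t : \int[leb]_s `|(V t * G s)%:E| =
      `|(V t)%:E| * \int[leb]_s `|(G s)%:E|.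
    under eq_integral do rewrite EFinM abseM.
    by rewrite (ge0_integralZl leb measurableT mabsG).
  under eq_integral do rewrite /= eqt.
  have [_ Goo] := integrableP _ _ _ iG; have [_ Voo] := integrableP _ _ _ iV.
  rewrite (ge0_integralZr leb measurableT mabsV); last 2 first.
  - by move=> t _; exact: abse_ge0.
  - by apply: integral_ge0 => t _; exact: abse_ge0.
  by rewrite lte_mul_pinfty// ?integral_ge0// ge0_fin_numE// integral_ge0.
have iK : (leb \x leb).-integrable [set: T * T] K.
  apply: (le_integrable _ mK _ iVG); first exact: measurableT.
  move=> z _; rewrite /K; case: ifP => _; first exact: lexx.
  by rewrite abse0.
have FK t : fubini_F leb K t =
    (((fun t => v t * \int[leb]_(s in `[a, t]) g s) \_ `[a, b]) t)%R%:E.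
  rewrite /fubini_F /K/= /V !patchE; case: ifPn => tab; last first.
    by under eq_integral do rewrite mul0r if_same; rewrite integral0.
  rewrite inE in tab.
  have igt : leb.-integrable `[a, t] (EFin \o g).
    apply: integrableS ig => //; apply: subset_itvl; rewrite bnd_simp.
    by move: tab; rewrite /= in_itv/= => /andP[].
  rewrite EFinM fineK; last exact: integrable_fin_num.
  rewrite -(integralZl (mI _) igt) integral_mkcond; apply: eq_integral => s _.
  rewrite patchE/= /G patchE !mem_setE.
  move: tab; rewrite !in_itv/= => /andP[at1 tb]; rewrite (andbC (a <= s)%R).
  case: (leP s t) => st; last by rewrite andbF.
  by rewrite (le_trans st tb)/=; case: ifP; rewrite // mulr0.
have GK s : fubini_G leb K s =
    (((fun s => g s * \int[leb]_(t in `[s, b]) v t) \_ `[a, b]) s)%R%:E.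
  rewrite /fubini_G /K/= /G !patchE; case: ifPn => sab; last first.
    by under eq_integral do rewrite mulr0 if_same; rewrite integral0.
  rewrite inE in sab.
  have ivs : leb.-integrable `[s, b] (EFin \o v).
    apply: (integrableS (mI _) (mI _) _ iv); apply: subset_itvr; rewrite bnd_simp.
    by move: sab; rewrite /= in_itv/= => /andP[].
  rewrite EFinM fineK; last exact: integrable_fin_num.
  rewrite -(integralZl (mI _) ivs) integral_mkcond; apply: eq_integral => t _.
  rewrite patchE/= /V patchE !mem_setE.
  move: sab; rewrite /= !in_itv/= => /andP[as1 sb].
  case: (leP s t) => st //=.
  by rewrite (le_trans as1 st)/=; case: ifP; rewrite ?mul0r// mulrC.
split.
- apply/(integrable_mkcond _ (mI _)).
  have := integrable_fubini_F iK; congr (integrable _ _ _).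
  by rewrite restrict_EFin; apply/funext => t; rewrite FK.
- apply/(measurable_restrictT _ (mI _)).
  apply/measurable_EFinP.
  have := measurable_fubini_G iK; congr (measurable_fun _ _).
  by apply/funext => t; rewrite GK.
- rewrite (Rintegral_mkcond leb `[a, b] (fun t => _ * _))%R.
  rewrite (Rintegral_mkcond leb `[a, b] (fun s => g s * _))%R.
  rewrite /Rintegral; congr (fine _).
  transitivity (\int[leb]_t fubini_F leb K t).
    by apply: eq_integral => t _; rewrite FK.
  transitivity (\int[leb]_s fubini_G leb K s); first exact: Fubini iK.
  by apply: eq_integral => s _; rewrite GK.
Qed.

End triangle.

(** * Weighted integrals and Hoelder's inequality *)

Section integral_formulas.
Context {R : realType}.
Implicit Types (a b : R).
Notation T := (lebType R).

Lemma slope_increment a b (f g : T -> R) t : t \in `[a, b] ->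
  slope_on `[a, b] f g -> leb.-integrable `[a, b] (EFin \o g) ->
  f t = f a + \int[leb]_(s in `[a, t]) g s.
Proof.
rewrite in_itv/= => /andP[at1 tb] fg ig.
have mI (i : interval R) : measurable ([set` i] : set T).
  exact: measurable_itv_leb.
have sub : `[a, t] `<=` `[a, b] by apply: subset_itvl; rewrite bnd_simp.
rewrite -(slope_FTC at1 (slope_onS sub fg)); first by rewrite addrCA subrr addr0.
exact: (integrableS (mI _) (mI _) sub ig).
Qed.

(** Insert f t = f a plus the integral of g over [a, t] and exchange the order
    of integration: the weight of g s becomes the mass of v beyond s. *)
Lemma weighted_integral_FTC a b (f v g : T -> R) :
  slope_on `[a, b] f g -> leb.-integrable `[a, b] (EFin \o g) ->
  leb.-integrable `[a, b] (EFin \o v) ->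
  leb.-integrable `[a, b] (fun t => (v t * f t)%:E) /\
  \int[leb]_(t in `[a, b]) (v t * f t) =
  f a * \int[leb]_(t in `[a, b]) v t +
  \int[leb]_(s in `[a, b]) (g s * \int[leb]_(t in `[s, b]) v t).
Proof.
move=> fg ig iv; have [ivG _ triE] := fubini_triangle iv ig.
have mI (i : interval R) : measurable ([set` i] : set T).
  exact: measurable_itv_leb.
have ifv := integrableZl (mI _) (f a) iv.
have vfE t : t \in (`[a, b]%classic : set T) ->
    v t * f t = f a * v t + v t * \int[leb]_(s in `[a, t]) g s.
  by rewrite inE => tab; rewrite {1}(slope_increment tab fg ig); ring.
split.
  have := integrableD (mI _) ifv ivG; apply: eq_integrable; first exact: mI.
  by move=> t tab; rewrite /= -EFinD vfE.
rewrite -triE -(RintegralZl (f a) (mI _) iv) -(RintegralD (mI _) ifv ivG).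
exact: eq_Rintegral.
Qed.

Lemma conjugate_exponent_gt0 (p q : R) : 1 < p -> p^-1 + q^-1 = 1 -> 0 < q.
Proof.
move=> p1 pq; rewrite -invr_gt0 -(addrK p^-1 q^-1) [q^-1 + _]addrC pq subr_gt0.
by rewrite invf_lt1// (lt_trans ltr01).
Qed.

Lemma in_Lp_integrable_powR a b p (g : T -> R) : 1 < p -> in_Lp a b p g ->
  leb.-integrable `[a, b] (fun x => (`|g x| `^ p)%:E).
Proof.
move=> p1 Lg; apply/(integrable_mkcond _ (@measurable_itv_leb R _)).
have := Lfun_integrable (ltW p1) Lg; congr (integrable _ _ _).
apply/funext => x; rewrite !patchE; case: ifP => // _.
by rewrite normr0 powR0// gt_eqF// (lt_trans ltr01).
Qed.

Lemma in_Lp_measurable a b p (g : T -> R) : in_Lp a b p g ->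
  measurable_fun (`[a, b] : set T) g.
Proof.
move=> Lg; apply/(measurable_restrictT _ (@measurable_itv_leb R _)).
by move: Lg; rewrite /in_Lp inE => /andP[/[!inE]/= + _].
Qed.

(** On a bounded interval, since y <= 1 + y ^ p for y >= 0. *)
Lemma in_Lp_integrable a b p (g : T -> R) : 1 < p -> in_Lp a b p g ->
  leb.-integrable `[a, b] (EFin \o g).
Proof.
move=> p1 Lg; have mD := @measurable_itv_leb R `[a, b].
have i1 : leb.-integrable `[a, b] (fun x => (1 + `|g x| `^ p)%:E).
  exact: (integrableD mD (integrable_cst_itv a b 1)
    (in_Lp_integrable_powR p1 Lg)).
apply: (le_integrable mD _ _ i1).
  by apply/measurable_EFinP; exact: in_Lp_measurable Lg.
move=> x _; rewrite !abse_EFin lee_fin.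
rewrite (ger0_norm (addr_ge0 ler01 (powR_ge0 _ _))).
have [g1|g1] := leP `|g x| 1; first by rewrite (le_trans g1)// lerDl powR_ge0.
by rewrite (le_trans (le1r_powR (ltW g1) (ltW p1)))// lerDr.
Qed.

(** Extend both functions by zero to apply the inequality on the whole line. *)
Lemma Rintegral_hoelder a b p q (g h : T -> R) :
  1 < p -> p^-1 + q^-1 = 1 -> in_Lp a b p g ->
  measurable_fun (`[a, b] : set T) h ->
  leb.-integrable `[a, b] (fun x => (`|h x| `^ q)%:E) ->
  `| \int[leb]_(x in `[a, b]) (g x * h x) | <= Lp_norm a b p g * Lp_norm a b q h.
Proof.
move=> p1 pq Lg mh ihq.
have p0 : 0 < p by rewrite (lt_trans ltr01).
have q0 := conjugate_exponent_gt0 p1 pq.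
have mI (i : interval R) : measurable ([set` i] : set T).
  exact: measurable_itv_leb.
pose G : T -> R := g \_ `[a, b]; pose H : T -> R := h \_ `[a, b].
have mH : measurable_fun [set: T] H by exact/(measurable_restrictT _ (mI _)).
have mG : measurable_fun [set: T] G.
  by apply/(measurable_restrictT _ (mI _)); exact: in_Lp_measurable Lg.
have LE r (k : T -> R) : 0 < r ->
    leb.-integrable `[a, b] (fun x => (`|k x| `^ r)%:E) ->
    Lnorm leb r%:E (EFin \o (k \_ `[a, b])) = (Lp_norm a b r k)%:E.
  move=> r0 ik; rewrite unlock /Lnorm /Lp_norm -poweR_EFin; congr poweR.
  rewrite /Rintegral fineK; last exact: integrable_fin_num.
  rewrite [RHS]integral_mkcond; apply: eq_integral => x _.
  by rewrite /= !patchE; case: ifP => // _; rewrite /= normr0 powR0// gt_eqF.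
have igp := in_Lp_integrable_powR p1 Lg.
have Ho := hoelder leb mG mH p0 q0 pq.
rewrite (LE _ g p0 igp) (LE _ h q0 ihq) Lnorm1 in Ho.
have GHE : (EFin \o (fun x => g x * h x)) \_ `[a, b] = EFin \o (G \* H).
  apply/funext => x; rewrite /= /G /H !patchE.
  by case: ifP => // _; rewrite mulr0.
have igh : leb.-integrable `[a, b] (EFin \o (fun x => g x * h x)).
  apply/(integrable_mkcond _ (mI _)); rewrite GHE; apply/integrableP; split.
    by apply/measurable_EFinP; exact: measurable_funM.
  by apply: le_lt_trans Ho _; rewrite -EFinM ltry.
rewrite -lee_fin EFin_normr_Rintegral//.
rewrite (integral_mkcond _ (EFin \o _)) GHE.
apply: le_trans (le_abse_integral leb measurableT _) Ho.
by apply/measurable_EFinP; exact: measurable_funM.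
Qed.

End integral_formulas.

(** * Integrals of powers *)

Section power.
Context {R : realType}.
Implicit Types (x y : R) (f F : R -> R).

(** An improper form: f may blow up at either endpoint, which happens for the
    derivatives of powers with exponent below 1. It follows by exhausting the
    open interval with compact ones, and monotone convergence. *)
Lemma ge0_FTC_open F f x y : x < y ->
  {in `]x, y[, forall z, 0 <= f z} -> {in `]x, y[, continuous f} ->
  (forall z : R, z \in `]x, y[ -> is_derive z 1 F (f z)) ->
  F @ x^'+ --> F x -> F @ y^'- --> F y ->
  (\int[lebesgue_measure]_(z in `]x, y[) (f z)%:E = (F y - F x)%:E)%E.
Proof.
move=> xy f0 cf dF Fx Fy.
have dFxy : derivable_oo_LRcontinuous F x y.
  by split => // z zxy; have [] := dF z zxy.
have F'f : {in `]x, y[, F^`()%classic =1 f}.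
  by move=> z zxy; rewrite derive1E; have [_ ->] := dF z zxy.
(* The compact intervals are [x + r n, y - r n], where r n < (y - x) / 2
   decreases to 0. *)
have [d d0 dE] : exists2 d, 0 < d & d = (y - x) / 2.
  by exists ((y - x) / 2); rewrite // divr_gt0// subr_gt0.
pose r (n : nat) : R := d / 2 / n.+1%:R.
have r0 n : 0 < r n by rewrite /r !divr_gt0.
have rd n : r n < d.
  by rewrite /r ltr_pdivrMr// ltr_pdivrMr// -mulrA ltr_pMr// -natrM ltr1n.
pose u n := x + r n; pose w n := y - r n.
have uw n : u n < w n.
  have := rd n; rewrite /u /w dE => H; lra.
have r_cvg : r @ \oo --> 0.
  by rewrite -[X in _ --> X](mulr0 (d / 2)); apply: cvgMr; exact: cvg_harmonic.
have u_cvg : u @ \oo --> x.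
  by rewrite -[X in _ --> X]addr0; apply: cvgD => //; exact: cvg_cst.
have w_cvg : w @ \oo --> y.
  by rewrite -[X in _ --> X]subr0; apply: cvgB => //; exact: cvg_cst.
have sub n : `[u n, w n] `<=` `]x, y[.
  by apply: subset_itv; rewrite bnd_simp ?ltrDl// ltrBlDr ltrDl.
have bigE : `]x, y[%classic = \bigcup_n (`[u n, w n]%classic : set (measurableTypeR R)).
  apply/seteqP; split => [z|z [n _]]; last exact: sub.
  rewrite /= in_itv/= => /andP[xz zy].
  have zxy0 : 0 < Num.min (z - x) (y - z) by rewrite lt_min !subr_gt0 xz.
  have /cvgrPdist_lt /(_ _ zxy0) [n _ /(_ n (leqnn n))] := r_cvg.
  rewrite /= sub0r normrN gtr0_norm// lt_min => /andP[rx ry]; exists n => //=.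
  by rewrite in_itv/= /u /w; apply/andP; split; [move: rx|move: ry]; lra.
have intE n : (\int[lebesgue_measure]_(z in `[u n, w n]) (f z)%:E =
    (F (w n) - F (u n))%:E)%E.
  rewrite EFinB; apply: continuous_FTC2; first exact: uw.
  - apply/continuous_in_subspaceT => z; rewrite inE => /sub zxy.
    exact: cf.
  - apply: derivable_oo_continuousW dFxy; first exact: uw.
    exact: subset_trans (sub n) (@subset_itv_oo_cc _ _ _ _).
  - move=> z zuw; apply: F'f; apply: sub; exact: subset_itv_oo_cc zuw.
have lim1 : (F (w n) - F (u n)) @[n --> \oo] --> F y - F x.
  apply: cvgB.
  - by move/cvg_at_leftP : Fy; apply; split => // n; rewrite ltrBlDr ltrDl.
  - by move/cvg_at_rightP : Fx; apply; split => // n; rewrite ltrDl.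
have lim2 : (\int[lebesgue_measure]_(z in `[u n, w n]) (f z)%:E @[n --> \oo] -->
   \int[lebesgue_measure]_(z in `]x, y[) (f z)%:E)%E.
  rewrite bigE; apply: ge0_nondecreasing_set_cvg_integral.
  - move=> m n mn; apply/subsetPset; apply: subset_itv; rewrite bnd_simp.
      by rewrite lerD2l ler_pM2l ?divr_gt0// lef_pV2 ?posrE// ler_nat.
    by rewrite lerD2l lerN2 ler_pM2l ?divr_gt0// lef_pV2 ?posrE// ler_nat.
  - by move=> n; exact: measurable_itv.
  - move=> n; apply/measurable_EFinP.
    apply: subspace_continuous_measurable_fun; first exact: measurable_itv.
    apply/continuous_in_subspaceT => z; rewrite inE => /sub zxy; exact: cf.
  - by move=> n z /sub zxy; rewrite lee_fin f0.
have lim1' : (F (w n) - F (u n))%:E @[n --> \oo] --> (F y - F x)%:E.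
  exact: cvg_comp lim1 _.
rewrite (eq_cvg _ _ intE) in lim2.
exact: cvg_unique lim2 lim1'.
Qed.

Lemma is_derive_reflected_powR (b c z : R) : z < b ->
  is_derive z 1 (fun t => - (b - t) `^ c) (c * (b - z) `^ (c - 1)).
Proof.
move=> zb; have bz : 0 < b - z by rewrite subr_gt0.
have dcomp := @is_derive1_comp _ (@powR R ^~ c) (fun t => b - t) z _ _
  (is_derive1_powR c bz) (is_deriveB (is_derive_cst b z 1) (is_derive_id z 1)).
have [dN EN] := is_deriveN dcomp.
by split; [exact: dN|rewrite [LHS]EN sub0r mulrN1 opprK].
Qed.

Lemma continuous_powR_gt0 (c z : R) : 0 < z -> {for z, continuous (@powR R ^~ c)}.
Proof.
move=> z0; apply/differentiable_continuous/derivable1_diffP.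
by apply: derivable_powR; rewrite in_itv/= z0.
Qed.

Lemma continuous_reflected_powR (b c z : R) : z < b ->
  {for z, continuous (fun t => (b - t) `^ c)}.
Proof.
move=> zb; apply: (@continuous_comp _ _ _ (fun t : R => b - t) (@powR R ^~ c)).
  by apply: cvgB; [exact: cvg_cst|exact: cvg_id].
by apply: continuous_powR_gt0; rewrite subr_gt0.
Qed.

Lemma measurable_reflected_powR (b c : R) :
  measurable_fun [set: R] (fun t : R => c * (b - t) `^ (c - 1)).
Proof.
apply: measurable_funM; first exact: measurable_cst.
apply: (measurableT_comp (measurable_powR _)).
by apply: measurable_funB; [exact: measurable_cst|exact: measurable_id].
Qed.

Lemma measurable_scaled_powR (c : R) :
  measurable_fun [set: R] (fun t : R => c * t `^ (c - 1)).
Proof.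
by apply: measurable_funM; [exact: measurable_cst|exact: measurable_powR].
Qed.

Lemma integral_reflected_powR (s b c : R) : s <= b -> 0 < c ->
  (\int[leb]_(t in `[s, b]) (c * (b - t) `^ (c - 1))%:E = ((b - s) `^ c)%:E)%E.
Proof.
move=> sb c0; rewrite ge0_integral_leb; last 3 first.
- exact: measurable_itv.
- apply/measurable_EFinP; apply: measurable_funTS.
  exact: measurable_reflected_powR.
- by move=> t _; rewrite lee_fin mulr_ge0 ?powR_ge0// ltW.
move: sb; rewrite le_eqVlt => /predU1P[->|sb].
  by rewrite set_itv1 integral_set1 subrr powR0// gt_eqF.
rewrite integral_itv_bndoo; last first.
  apply/measurable_EFinP; apply: measurable_funTS.
  exact: measurable_reflected_powR.
apply: etrans.
  apply: (@ge0_FTC_open (fun t => - (b - t) `^ c) _ s b sb).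
  - by move=> z _; rewrite mulr_ge0 ?powR_ge0// ltW.
  - move=> z; rewrite in_itv/= => /andP[_ zb].
    by apply: cvgMr; exact: continuous_reflected_powR.
  - by move=> z; rewrite in_itv/= => /andP[_]; exact: is_derive_reflected_powR.
  - by apply: cvg_at_right_filter; apply: cvgN; exact: continuous_reflected_powR.
  - rewrite subrr powR0 ?gt_eqF//; apply: cvgN.
    apply/cvg_at_leftP => u [ub ucvg].
    move/cvg_at_rightP : (powR_cvg0 c0) => /(_ (fun n => b - u n)); apply.
    split=> [n|]; first by rewrite subr_gt0.
    by rewrite -[X in _ --> X](subrr b); apply: cvgB => //; exact: cvg_cst.
by rewrite /= subrr powR0 ?gt_eqF// oppr0 sub0r opprK.
Qed.

Lemma integral_scaled_powR (y c : R) : 0 < y -> 0 < c ->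
  (\int[leb]_(t in `]0%R, y]) (c * t `^ (c - 1))%:E = (y `^ c)%:E)%E.
Proof.
move=> y0 c0; rewrite ge0_integral_leb; last 3 first.
- exact: measurable_itv.
- by apply/measurable_EFinP; apply: measurable_funTS; exact: measurable_scaled_powR.
- by move=> t _; rewrite lee_fin mulr_ge0 ?powR_ge0// ltW.
rewrite integral_itv_bndoo; last first.
  by apply/measurable_EFinP; apply: measurable_funTS; exact: measurable_scaled_powR.
apply: etrans.
  apply: (@ge0_FTC_open (@powR R ^~ c) _ 0 y y0).
  - by move=> z _; rewrite mulr_ge0 ?powR_ge0// ltW.
  - move=> z; rewrite in_itv/= => /andP[z0 _].
    apply: cvgMr.
    exact: continuous_powR_gt0.
  - by move=> z; rewrite in_itv/= => /andP[z0 _]; exact: is_derive1_powR.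
  - by rewrite powR0 ?gt_eqF//; exact: powR_cvg0.
  - by apply: cvg_at_left_filter; exact: continuous_powR_gt0.
by rewrite /= powR0 ?gt_eqF// subr0.
Qed.

Lemma integrable_reflected_powR (s b c : R) : s <= b -> 0 < c ->
  leb.-integrable `[s, b] (fun t : lebType R => (c * (b - t) `^ (c - 1))%:E).
Proof.
move=> sb cpos; apply/integrableP; split.
  apply/measurable_EFinP; apply: measurable_fun_borel_leb.
    exact: measurable_itv.
  by apply: measurable_funTS; exact: measurable_reflected_powR.
have -> : (\int[leb]_(t in `[s, b]) `|(c * (b - t) `^ (c - 1))%:E|)%E =
    ((b - s) `^ c)%:E.
  rewrite -(integral_reflected_powR sb cpos); apply: eq_integral => t _.
  by rewrite gee0_abs// lee_fin; apply: mulr_ge0; [exact: ltW|exact: powR_ge0].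
exact: ltry.
Qed.

End power.

(** * The Gamma integral *)

Section gamma.
Context {R : realType}.
Local Open Scope ereal_scope.
Notation T := (lebType R).

(** The same integral as Gamma, in the extended reals: its functional equation
    can be proved before its finiteness, and then yields it. *)
Definition eGamma (s : R) : \bar R :=
  \int[leb]_(t in `]0%R, +oo[) (t `^ (s - 1) * expR (- t))%:E.

Lemma measurable_expRN : measurable_fun [set: R] (fun t : R => expR (- t)).
Proof. by apply: measurableT_comp => //; exact: measurable_oppr. Qed.

Lemma is_derive_expRN (x : R) :
  is_derive x 1%R (fun t : R => - expR (- t))%R (expR (- x)).
Proof.
have dcomp := @is_derive1_comp _ expR -%R x _ _ (is_derive_expR (- x))
  (is_deriveN (is_derive_id x 1%R)).
have [dN EN] := is_deriveN dcomp.
by split; [exact: dN|rewrite [LHS]EN mulrN1 opprK].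
Qed.

Lemma continuous_expRN : continuous (fun t : R => expR (- t)).
Proof.
move=> x; apply: (@continuous_comp _ _ _ -%R expR).
  exact: opp_continuous.
exact: continuous_expR.
Qed.

Lemma integral_exp_tail (s : R) :
  \int[leb]_(t in `[s, +oo[) (expR (- t))%:E = (expR (- s))%:E.
Proof.
rewrite ge0_integral_leb; last 3 first.
- exact: measurable_itv.
- apply/measurable_EFinP; apply: measurable_funTS; exact: measurable_expRN.
- by move=> t _; rewrite lee_fin expR_ge0.
rewrite (@ge0_continuous_FTC2y _ _ (fun t => - expR (- t))%R s 0%R).
- by rewrite sub0e -EFinN opprK.
- by move=> x _; exact: expR_ge0.
- by apply: continuous_subspaceT; exact: continuous_expRN.
- rewrite -oppr0; apply: cvgN; exact: cvgr_expR.
- by move=> x _; have [] := is_derive_expRN x.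
- by apply: cvg_at_right_filter; apply: cvgN; exact: continuous_expRN.
- by move=> x _; rewrite derive1E; have [_ ->] := is_derive_expRN x.
Qed.

(** In the integral of t ^ c exp (- t), write t ^ c as the integral of
    c s ^ (c - 1) over s <= t and exchange the integrals by Tonelli's theorem:
    the inner integral of exp (- t) over t >= s is exp (- s). *)
Lemma eGammaD1 (c : R) : (0 < c)%R -> eGamma (c + 1) = c%:E * eGamma c.
Proof.
move=> c0.
have mI (i : interval R) : measurable ([set` i] : set T).
  exact: measurable_itv_leb.
pose S : T -> R := ((fun s => c * s `^ (c - 1)) \_ `]0, +oo[)%R.
pose E : T -> R := fun t => expR (- t).
have mE : measurable_fun [set: T] E.
  by apply: measurable_fun_borel_leb => //; exact: measurable_expRN.
have mPc (i : interval R) :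
    measurable_fun ([set` i] : set T) (fun s : T => c * s `^ (c - 1))%R.
  apply: measurable_fun_borel_leb; first exact: measurable_itv.
  by apply: measurable_funTS; exact: measurable_scaled_powR.
have mP (i : interval R) :
    measurable_fun ([set` i] : set T) (fun s : T => (c * s `^ (c - 1))%:E).
  by apply/measurable_EFinP; exact: mPc.
have mS : measurable_fun [set: T] S.
  by apply/(measurable_restrictT _ (mI _)); exact: mPc.
have S0 s : (0 <= S s)%R.
  by rewrite /S patchE; case: ifP => // _; rewrite mulr_ge0 ?powR_ge0// ltW.
pose K (z : T * T) : \bar R :=
  (if (z.2 <= z.1)%R then E z.1 * S z.2 else 0)%R%:E.
have mK : measurable_fun [set: T * T] K.
  by apply/measurable_EFinP; exact: measurable_leb_triangle.
have K0 z : 0 <= K z.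
  by rewrite lee_fin; case: ifP => // _; rewrite mulr_ge0 ?expR_ge0.
have FT := @fubini_tonelli _ _ T T R leb leb K mK K0.
have FL : \int[leb]_t \int[leb]_s K (t, s) = eGamma (c + 1).
  rewrite /eGamma [RHS]integral_mkcond; apply: eq_integral => t _.
  rewrite patchE mem_setE in_itv/= andbT; case: ltP => t0; last first.
    apply: integral0_eq => s _; rewrite /K /=.
    case: (leP s t) => st; last by [].
    rewrite /S patchE mem_setE in_itv/= andbT ltNge (le_trans st t0).
    by rewrite mulr0.
  rewrite addrK mulrC EFinM -(integral_scaled_powR t0 c0).
  rewrite -ge0_integralZl_EFin; last 4 first.
  - exact: mI.
  - move=> s _; rewrite lee_fin.
    by apply: mulr_ge0; [exact: ltW|exact: powR_ge0].
  - exact: mP.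
  - exact: expR_ge0.
  rewrite [RHS]integral_mkcond; apply: eq_integral => s _.
  rewrite /K /= patchE mem_setE in_itv/= andbC.
  case: (leP s t) => st; last by [].
  rewrite /S patchE mem_setE in_itv/= andbT.
  by case: ifP => _; rewrite ?mulr0// EFinM.
have FR : \int[leb]_s \int[leb]_t K (t, s) = c%:E * eGamma c.
  rewrite /eGamma -ge0_integralZl_EFin; last 4 first.
  - exact: mI.
  - move=> s _; rewrite lee_fin.
    by apply: mulr_ge0; [exact: powR_ge0|exact: expR_ge0].
  - apply/measurable_EFinP; apply: measurable_fun_borel_leb.
      exact: measurable_itv.
    by apply: measurable_funM; apply: measurable_funTS;
      [exact: measurable_powR|exact: measurable_expRN].
  - exact: ltW.
  rewrite [RHS]integral_mkcond; apply: eq_integral => s _.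
  rewrite patchE; case: ifP => s0; last first.
    apply: integral0_eq => t _; rewrite /K /= /S patchE s0 mulr0.
    by case: ifP.
  rewrite EFinM muleA -(integral_exp_tail s).
  rewrite -EFinM -ge0_integralZl_EFin; last 4 first.
  - exact: mI.
  - by move=> t _; rewrite lee_fin; exact: expR_ge0.
  - apply/measurable_EFinP; exact: measurable_funTS.
  - by apply: mulr_ge0; [exact: ltW|exact: powR_ge0].
  rewrite [RHS]integral_mkcond; apply: eq_integral => t _.
  rewrite /K /= patchE mem_setE in_itv/= andbT /S patchE s0.
  by case: (leP s t) => st; rewrite -?EFinM ?(mulrC (E t)).
exact: etrans (esym FL) (etrans FT FR).
Qed.

Lemma measurable_Gamma_integrand (s : R) (D : set R) : measurable D ->
  measurable_fun (D : set T) (fun t : T => (t `^ (s - 1) * expR (- t))%:E).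
Proof.
move=> mD; apply/measurable_EFinP; apply: measurable_fun_borel_leb => //.
by apply: measurable_funM; apply: measurable_funTS;
  [exact: measurable_powR|exact: measurable_expRN].
Qed.

Lemma Gamma_integrand_ge0 (s t : R) : 0 <= (t `^ (s - 1) * expR (- t))%:E.
Proof. by rewrite lee_fin mulr_ge0 ?powR_ge0 ?expR_ge0. Qed.

Lemma eGamma1 : eGamma 1 = 1.
Proof.
rewrite /eGamma; transitivity (\int[leb]_(t in `]0%R, +oo[) (@expR R (- t))%:E).
  by apply: eq_integral => t _; rewrite subrr powRr0 mul1r.
have -> : 1 = (expR (- 0%R))%:E :> \bar R by rewrite oppr0 expR0.
rewrite -integral_exp_tail.
have mexp (i : interval R) :
    measurable_fun [set` i] (fun t : R => (expR (- t))%:E).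
  by apply/measurable_EFinP; apply: measurable_funTS; exact: measurable_expRN.
rewrite !ge0_integral_leb.
- by rewrite integral_itv_obnd_cbnd.
- exact: measurable_itv.
- exact: mexp.
- by move=> t _; rewrite lee_fin expR_ge0.
- exact: measurable_itv.
- exact: mexp.
- by move=> t _; rewrite lee_fin expR_ge0.
Qed.

Lemma eGamma_nat n : eGamma n.+1%:R < +oo.
Proof.
elim: n => [|n IHn]; first by rewrite eGamma1 ltry.
rewrite -natr1 eGammaD1//; apply: lte_mul_pinfty => //.
Qed.

(** Compare t ^ (s - 1) with 1 + t ^ n, where n >= s - 1; the values at the
    positive integers are finite by the functional equation. *)
Lemma eGamma_lty (s : R) : (1 <= s)%R -> eGamma s < +oo.
Proof.
move=> s1; have [n sn] : exists n, (s - 1 <= n%:R)%R.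
  exists (Num.truncn (s - 1)).+1.
  by rewrite ltW// truncnS_gt// subr_ge0.
apply: (@le_lt_trans _ _ (eGamma 1 + eGamma n.+1%:R)); last first.
  by rewrite lte_add_pinfty// ?eGamma1 ?ltry ?eGamma_nat.
have mD : measurable (`]0%R, +oo[ : set T) by exact: measurable_itv_leb.
have mg z := @measurable_Gamma_integrand z _ (@measurable_itv R `]0%R, +oo[).
rewrite /eGamma -(ge0_integralD leb mD _ (mg _) _ (mg _)); last 2 first.
- by move=> t _; exact: Gamma_integrand_ge0.
- by move=> t _; exact: Gamma_integrand_ge0.
apply: (ge0_le_integral leb mD _ (mg _)).
- by move=> t _; exact: Gamma_integrand_ge0.
- by apply: emeasurable_funD; exact: mg.
move=> t; rewrite /= in_itv/= andbT => t0.
rewrite -EFinD lee_fin subrr powRr0 -mulrDl ler_wpM2r ?expR_ge0//.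
rewrite -natr1 addrK; have [t1|t1] := leP t 1%R.
  rewrite (@le_trans _ _ 1%R)// ?lerDl ?powR_ge0//.
  have : (t `^ (s - 1) <= 1 `^ (s - 1))%R.
    by apply: ge0_ler_powR; rewrite ?nnegrE ?subr_ge0// ltW.
  by rewrite powR1.
rewrite (@le_trans _ _ (t `^ n%:R)%R)// ?lerDr//.
by apply: ler_powR => //; exact: ltW.
Qed.

(** The integrand is at least exp (- t) for t >= 1. *)
Lemma eGamma_gt0 (s : R) : (1 <= s)%R -> 0 < eGamma s.
Proof.
move=> s1; apply: (@lt_le_trans _ _ (expR (- 1))%:E).
  by rewrite lte_fin expR_gt0.
have mI (i : interval R) : measurable ([set` i] : set T).
  exact: measurable_itv_leb.
have mg (i : interval R) := @measurable_Gamma_integrand s _ (@measurable_itv R i).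
rewrite -integral_exp_tail; apply: (@le_trans _ _
  (\int[leb]_(t in `[1%R, +oo[) (t `^ (s - 1) * expR (- t))%:E)).
  apply: (ge0_le_integral leb (mI _)).
  - by move=> t _; rewrite lee_fin expR_ge0.
  - apply/measurable_EFinP; apply: measurable_fun_borel_leb.
      exact: measurable_itv.
    by apply: measurable_funTS; exact: measurable_expRN.
  - exact: mg.
  move=> t; rewrite /= in_itv/= andbT => t1.
  rewrite lee_fin ler_peMl ?expR_ge0//.
  have : (t `^ 0 <= t `^ (s - 1))%R by apply: ler_powR; rewrite ?subr_ge0.
  by rewrite powRr0.
apply: ge0_subset_integral; [exact: mI|exact: mI|exact: mg| |].
- by move=> t _; exact: Gamma_integrand_ge0.
- by apply: subset_itvr; rewrite bnd_simp.
Qed.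

(** The bounds at s + 1 >= 1 come down to s through the functional equation. *)
Lemma eGamma_fin (s : R) : (0 < s)%R -> 0 < eGamma s < +oo.
Proof.
move=> s0; have := eGammaD1 s0.
have s1 : (1 <= s + 1)%R by rewrite lerDr ltW.
have := eGamma_gt0 s1; have := eGamma_lty s1 => + + Es; rewrite Es.
have : 0 <= eGamma s.
  by apply: integral_ge0 => t _; exact: Gamma_integrand_ge0.
case: (eGamma s) => [r||] // r0.
- by rewrite -EFinM !ltry !lte_fin pmulr_rgt0 // andbT.
- by rewrite gt0_muley ?lte_fin.
Qed.

Lemma Gamma_gt0 (s : R) : (0 < s)%R -> (0 < Gamma s)%R.
Proof. by move=> s0; apply: fine_gt0; exact: eGamma_fin. Qed.

Lemma GammaD1 (s : R) : (0 < s)%R -> Gamma (s + 1) = (s * Gamma s)%R.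
Proof.
move=> s0; rewrite /Gamma /Rintegral -/(eGamma _) eGammaD1// fineM//.
have /andP[g0 gy] := eGamma_fin s0.
by rewrite ge0_fin_numE// ltW.
Qed.

Lemma Gamma1 : Gamma (1 : R) = 1%R.
Proof. by rewrite /Gamma /Rintegral -/(eGamma 1) eGamma1. Qed.

End gamma.

(** * Means for a probability density *)

Section weighted_mean.
Context {R : realType}.
Implicit Types (a b : R).
Notation T := (lebType R).

Lemma ge0_mass_tail a b (v : T -> R) s : s \in `[a, b] ->
  (forall t, t \in `[a, b] -> 0 <= v t) ->
  leb.-integrable `[a, b] (EFin \o v) ->
  0 <= \int[leb]_(t in `[s, b]) v t <= \int[leb]_(t in `[a, b]) v t.
Proof.
move=> sab v0 iv.
have mI (i : interval R) : measurable ([set` i] : set T).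
  exact: measurable_itv_leb.
have sub : `[s, b] `<=` `[a, b].
  by apply: subset_itvr; rewrite bnd_simp (itvP sab).
have ivs := integrableS (mI _) (mI _) sub iv.
apply/andP; split.
  by apply: Rintegral_ge0 => t /sub; exact: v0.
rewrite -lee_fin !fineK; try exact: integrable_fin_num.
apply: ge0_subset_integral;
  [exact: mI|exact: mI|exact: measurable_int iv| |exact: sub].
by move=> t tab; rewrite lee_fin v0.
Qed.

(** The endpoint s is counted twice, which is harmless as {s} is null. *)
Lemma mass_split a b (v : T -> R) s : s \in `[a, b] ->
  leb.-integrable `[a, b] (EFin \o v) ->
  \int[leb]_(t in `[a, b]) v t =
  \int[leb]_(t in `[a, s]) v t + \int[leb]_(t in `[s, b]) v t.
Proof.
move=> sab iv.
have mI (i : interval R) : measurable ([set` i] : set T).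
  exact: measurable_itv_leb.
have [as1 sb] : a <= s /\ s <= b by rewrite (itvP sab) (itvP sab).
have abE : `[a, b]%classic = `[a, s]%classic `|` `]s, b]%classic.
  by rewrite -itv_bndbnd_setU// bnd_simp.
have sbE : `[s, b]%classic = [set s] `|` `]s, b]%classic.
  by rewrite -set_itv1 -itv_bndbnd_setU// bnd_simp.
have s0 : leb [set s] = 0%E by rewrite leb_borelE lebesgue_measure_set1.
have mset1 : measurable ([set s] : set T) by rewrite -set_itv1; exact: mI.
have sub : `[s, b] `<=` `[a, b] by apply: subset_itvr; rewrite bnd_simp.
have ivs := integrableS (mI _) (mI _) sub iv.
rewrite sbE in ivs.
rewrite abE Rintegral_setU; last 4 first.
- exact: mI.
- exact: mI.
- by rewrite -abE.
- apply/disj_setPS => z [] /=; rewrite !in_itv/= => /andP[_ zs] /andP[].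
  by rewrite ltNge zs.
rewrite [in RHS]sbE [in RHS]Rintegral_setU; last 4 first.
- exact: mset1.
- exact: mI.
- exact: ivs.
- by apply/disj_setPS => z [] /= ->; rewrite in_itv/= ltxx.
have -> : \int[leb]_(t in [set s]) v t = 0.
  have ivs1 : leb.-integrable [set s] (EFin \o v).
    by apply: integrableS ivs; [exact: measurableU|exact: mset1|exact: subsetUl].
  by rewrite /Rintegral (null_set_integral mset1 (measurable_int _ ivs1) s0).
by rewrite add0r.
Qed.

(** The mean of f for a probability density v differs from f a by the integral
    of f' against the tail of v; the tail takes values in [0, 1], so Hoelder's
    inequality applies. *)
Lemma weighted_mean_bound a b (f v : T -> R) p q : a <= b ->
  (forall x, x \in `[a, b] -> derivable_within `[a, b] f x) ->
  1 < p -> p^-1 + q^-1 = 1 -> in_Lp a b p (derive_within `[a, b] f) ->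
  (forall t, t \in `[a, b] -> 0 <= v t) ->
  leb.-integrable `[a, b] (EFin \o v) -> \int[leb]_(t in `[a, b]) v t = 1 ->
  `| \int[leb]_(t in `[a, b]) (v t * f t) - f a | <=
  Lp_norm a b p (derive_within `[a, b] f) *
  Lp_norm a b q (fun s => \int[leb]_(t in `[s, b]) v t).
Proof.
move=> ab df p1 pq Lf' v0 iv v1.
have Sf := derivable_within_slope df.
have ig := in_Lp_integrable p1 Lf'.
rewrite (weighted_integral_FTC Sf ig iv).2 v1 mulr1 addrAC subrr add0r.
have mI (i : interval R) : measurable ([set` i] : set T).
  exact: measurable_itv_leb.
have mV : measurable_fun (`[a, b] : set T)
    (fun s : T => \int[leb]_(t in `[s, b]) v t).
  have [_ + _] := fubini_triangle iv (integrable_cst_itv a b 1).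
  by congr (measurable_fun _ _); apply/funext => s; rewrite /= mul1r.
apply: Rintegral_hoelder => //.
apply: (le_integrable (mI _) _ _ (integrable_cst_itv a b 1)).
  apply/measurable_EFinP; apply: (measurableT_comp (measurable_powR q)).
  exact: measurableT_comp.
move=> s sab; have /andP[V0 V1] := ge0_mass_tail sab v0 iv.
rewrite v1 in V1; rewrite !abse_EFin lee_fin normr1 ger0_norm ?powR_ge0//.
rewrite ger0_norm//; have q0 := conjugate_exponent_gt0 p1 pq.
have : (\int[leb]_(t in `[s, b]) v t) `^ q <= 1 `^ q.
  by apply: ge0_ler_powR; rewrite ?nnegrE// ltW.
by rewrite powR1.
Qed.

Lemma cdf_tail a b (w : R -> R) s : is_pdf a b w -> s \in `[a, b] ->
  \int[leb]_(t in `[s, b]) w t = 1 - cdf_on a b w s.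
Proof.
move=> [w0 iw w1] sab; have := mass_split sab iw.
rewrite /cdf_on w1 ltNge [b < s]ltNge !(itvP sab)/= => ->.
by rewrite addrAC subrr add0r.
Qed.

Section power_weight.
Context (a b alpha : R) (ab : a < b) (alpha0 : 0 < alpha).

(** The probability density on [a, b] whose mean of f is, up to the factor
    Gamma (alpha + 1) / (b - a) ^ alpha, the fractional integral of f at b. *)
Let v (t : T) : R := ((b - a) `^ alpha)^-1 * (alpha * (b - t) `^ (alpha - 1)).

Lemma power_weight_ge0 t : 0 <= v t.
Proof.
by rewrite /v mulr_ge0 ?invr_ge0 ?mulr_ge0 ?powR_ge0// ltW.
Qed.

Lemma power_weight_integrable : leb.-integrable `[a, b] (EFin \o v).
Proof.
have := integrableZl (@measurable_itv_leb R _) ((b - a) `^ alpha)^-1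
  (integrable_reflected_powR (ltW ab) alpha0).
by [].
Qed.

Lemma power_weight_tail s : s \in `[a, b] ->
  \int[leb]_(t in `[s, b]) v t = ((b - s) / (b - a)) `^ alpha.
Proof.
move=> sab; have sb : s <= b by rewrite (itvP sab).
rewrite RintegralZl; [|exact: measurable_itv_leb|exact: integrable_reflected_powR].
rewrite /Rintegral (integral_reflected_powR sb alpha0)/=.
rewrite powRM ?subr_ge0 ?invr_ge0 ?subr_ge0 ?(ltW ab)//.
rewrite -[(b - a)^-1]powR_inv1 ?subr_ge0 ?(ltW ab)//.
by rewrite -powRrM mulN1r powRN mulrC.
Qed.

Lemma power_weight_Lp_norm q : 0 < q ->
  Lp_norm a b q (fun s => \int[leb]_(t in `[s, b]) v t) =
  ((b - a) / (alpha * q + 1)) `^ q^-1.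
Proof.
move=> q0; rewrite /Lp_norm; congr (_ `^ _).
have ba : 0 < b - a by rewrite subr_gt0.
pose c := alpha * q + 1; have cpos : 0 < c by rewrite ltr_wpDl// mulr_ge0// ltW.
(* The q-th power of the tail is a multiple of c (b - s) ^ (c - 1) with
   c = alpha q + 1, so its integral is known. *)
transitivity (\int[leb]_(s in `[a, b])
    (((b - a) `^ (alpha * q) * c)^-1 * (c * (b - s) `^ (c - 1)))).
  apply: eq_Rintegral => s; rewrite inE => sab.
  have sb : 0 <= b - s by rewrite subr_ge0 (itvP sab).
  rewrite (power_weight_tail sab) ger0_norm ?powR_ge0// -powRrM.
  rewrite powRM ?invr_ge0 ?(ltW ba)// -[(b - a)^-1]powR_inv1 ?(ltW ba)//.
  rewrite -powRrM mulN1r powRN /c addrK.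
  by field; rewrite -/c gt_eqF//= gt_eqF// powR_gt0.
rewrite RintegralZl; [|exact: measurable_itv_leb
  |exact: integrable_reflected_powR (ltW ab) cpos].
rewrite /Rintegral (integral_reflected_powR (ltW ab) cpos)/=.
rewrite /c powRD ?(gt_eqF ba) ?implybT// powRr1 ?(ltW ba)// -/c.
by field; rewrite -/c gt_eqF//= gt_eqF// powR_gt0.
Qed.

End power_weight.

End weighted_mean.

(** * The inequality *)

Theorem theorem3 (R : realType) (a b : R) (ha : 0 <= a) (hab : a < b)
  (w : R -> R) (hw : is_pdf a b w)
  (f : R -> R)
  (hf : forall x, x \in `[a, b] -> derivable_within `[a, b] f x)
  (p q : R) (hp : 1 < p) (hpq : p^-1 + q^-1 = 1)
  (hf' : in_Lp a b p (derive_within `[a, b] f))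
  (alpha : R) (halpha : 0 <= alpha) :
  let W := cdf_on a b w in
  `| Gamma (alpha + 1) * RL_integral a alpha f b
     - (b - a) `^ alpha * \int[leb]_(s in `[a, b]) (w s * f s) |
  <= Lp_norm a b p (derive_within `[a, b] f) * (b - a) `^ alpha *
     ((\int[leb]_(s in `[a, b]) (`| W s - 1 | `^ q)) `^ q^-1
      + ((b - a) / (alpha * q + 1)) `^ q^-1).
Proof.
lazy zeta; set W := cdf_on a b w; have [w0 iw w1] := hw.
set N := Lp_norm a b p _; set c := (b - a) `^ alpha.
set I := \int[leb]_(s in `[a, b]) (w s * f s).
have q0 := conjugate_exponent_gt0 hp hpq.
(* Both means are compared with f a. *)
have Hw : `|I - f a| <=
    N * (\int[leb]_(s in `[a, b]) (`| W s - 1 | `^ q)) `^ q^-1.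
  have := weighted_mean_bound (ltW hab) hf hp hpq hf' w0 iw w1.
  move/le_trans; apply; rewrite /Lp_norm -/N le_eqVlt; apply/orP; left.
  apply/eqP; congr (N * (_ `^ q^-1)).
  apply: eq_Rintegral => s; rewrite inE => sab.
  by rewrite (cdf_tail hw sab) distrC.
(* X is the normalized fractional integral: the value f b (a point mass at b)
   when alpha = 0, the mean for the power density otherwise. *)
have [X XE HX] : exists2 X, Gamma (alpha + 1) * RL_integral a alpha f b = c * X &
    `|X - f a| <= N * ((b - a) / (alpha * q + 1)) `^ q^-1.
  have [alpha0|alpha_neq0] := eqVneq alpha 0.
    exists (f b).
      by rewrite /RL_integral alpha0 eqxx add0r Gamma1 /c alpha0 powRr0.
    have Sf := derivable_within_slope hf.
    have ig := in_Lp_integrable hp hf'.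
    rewrite (slope_FTC (ltW hab) Sf ig) alpha0 mul0r add0r divr1.
    have := @Rintegral_hoelder R a b p q _ (cst 1) hp hpq hf' (measurable_cst _).
    have norm1 x : (`|cst (1 : R) x| `^ q)%:E = 1%:E.
      by rewrite /cst normr1 powR1.
    have -> : Lp_norm a b q (cst 1) = (b - a) `^ q^-1.
      rewrite /Lp_norm /Rintegral; congr (_ `^ _).
      rewrite (eq_integral (cst 1%:E)); last by move=> x _; exact: norm1.
      rewrite (integral_cst leb (@measurable_itv_leb R _)) mul1e.
      by rewrite [X in fine X]leb_itv/= lte_fin hab.
    under eq_Rintegral do rewrite mulr1.
    apply; apply: eq_integrable (integrable_cst_itv a b 1).
      exact: measurable_itv_leb.
    by move=> x _; rewrite norm1.
  have alpha0 : 0 < alpha by rewrite lt_neqAle eq_sym alpha_neq0.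
  pose v (t : R) := c^-1 * (alpha * (b - t) `^ (alpha - 1)).
  have c0 : c != 0 by rewrite gt_eqF// powR_gt0// subr_gt0.
  have iv : leb.-integrable `[a, b] (EFin \o v).
    exact: power_weight_integrable.
  have [ivf _] := weighted_integral_FTC (derivable_within_slope hf)
    (in_Lp_integrable hp hf') iv.
  exists (\int[leb]_(t in `[a, b]) (v t * f t)).
    rewrite /RL_integral (negbTE alpha_neq0) (GammaD1 alpha0).
    have -> : \int[leb]_(t in `[a, b]) ((b - t) `^ (alpha - 1) * f t) =
        c / alpha * \int[leb]_(t in `[a, b]) (v t * f t).
      rewrite -(RintegralZl _ (@measurable_itv_leb R _) ivf).
      by apply: eq_Rintegral => t _; rewrite /v; field; rewrite c0.
    have G0 := Gamma_gt0 alpha0.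
    by field; rewrite alpha_neq0 gt_eqF.
  rewrite -(power_weight_Lp_norm hab alpha0 q0).
  apply: weighted_mean_bound => //; first exact: ltW.
  - by move=> t _; exact: power_weight_ge0.
  - rewrite power_weight_tail ?in_itv/= ?lexx ?(ltW hab)//.
    by rewrite divff ?powR1// gt_eqF// subr_gt0.
rewrite XE -mulrBr normrM ger0_norm ?powR_ge0//.
rewrite [N * c]mulrC -mulrA ler_wpM2l ?powR_ge0// mulrDr.
rewrite (_ : X - I = (X - f a) + (f a - I)); last by ring.
rewrite (le_trans (ler_normD _ _))// addrC lerD//.
by rewrite distrC.
Qed.
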